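(* Let $K\subset\mathbb{C}$ be a field, let $\ell$ be a prime such that $K$ contains all $\ell$-th roots of unity, and let $A\in K$ be such that $r^{\ell}-A$ is irreducible over $K$, with a root $\rho\in\mathbb{C}$. Let $p(x)\in K[x]$ be a polynomial with distinct roots, let $V$ be a resolvent of $p$ with coefficients in $K$, and let $q$ be an irreducible factor over $K$ of the corresponding auxiliary polynomial of $p$. Suppose that $q$ becomes reducible over $K(\rho)$. Then the Galois group of $p$ over $K(\rho)$, as a group of permutations of the roots of $p$, is a normal subgroup of the Galois group of $p$ over $K$, and the quotient group is cyclic of prime order $\ell$.
   Context: Let $p$ have distinct roots $r_1,\dots,r_n\in\mathbb{C}$. A resolvent of $p$ with coefficients in $K$ is an expression $V(r_1,\dots,r_n)=a_1r_1+\dots+a_nr_n$ with $a_i\in K$ such that the $n!$ values $V(r_{\sigma(1)},\dots,r_{\sigma(n)})$, $\sigma\in S_n$, are pairwise distinct. The corresponding auxiliary polynomial is $\prod_{\sigma\in S_n}\bigl(X-V(r_{\sigma(1)},\dots,r_{\sigma(n)})\bigr)$, which has coefficients in $K$. For a field $L$ with $K\subset L\subset\mathbb{C}$, the Galois group of $p$ over $L$ is the Galois group of $L(r_1,\dots,r_n)$ over $L$, identified with a group of permutations of $\{r_1,\dots,r_n\}$. *)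

(* Defs.v *)
From HB Require Import structures.
From mathcomp Require Import all_boot all_order all_algebra.
From mathcomp Require Import all_fingroup all_solvable.
From mathcomp Require Import boolp reals.
From mathcomp Require Export complex.

Set Implicit Arguments.
Unset Strict Implicit.
Unset Printing Implicit Defensive.

Import GRing.Theory GroupScope.
Local Open Scope ring_scope.

(* A subfield of the field [F] is a [K : divringClosed F], that is, a predicate
   containing 1 and closed under subtraction and division; [p \is a polyOver K]
   then says that [p] has its coefficients in the subfield [K]. *)

Section Adjoin.
Variable F : fieldType.

(* [adjoin L s] is L(s_1, ..., s_n): the intersection of all the subfields of
   [F] that contain [L] and the elements of [s]. *)
Definition adjoin (L : divringClosed F) (s : seq F) : {pred F} :=
  [pred x | `[< forall M : divringClosed F,
                  {subset L <= M} -> {subset s <= M} -> x \in M >]].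

Lemma adjoin_divring (L : divringClosed F) (s : seq F) :
  divring_closed (adjoin L s).
Proof.
split=> [|x y /asboolP xP /asboolP yP|x y /asboolP xP /asboolP yP];
  apply/asboolP => M sLM ssM.
- exact: rpred1.
- by rewrite rpredB ?xP ?yP.
- by rewrite rpred_div ?xP ?yP.
Qed.

HB.instance Definition _ (L : divringClosed F) (s : seq F) :=
  GRing.isDivringClosed.Build F (adjoin L s) (adjoin_divring L s).

End Adjoin.

Section Irreducibility.
Variable F : fieldType.

(* [irreducible_poly] would test for factors over all of [F]; here the factors
   are required to have coefficients in the subfield [L]. *)
Definition irreducible_over (L : divringClosed F) (q : {poly F}) : Prop :=
  [/\ q \is a polyOver L, (1 < size q)%N
    & forall f g : {poly F}, f \is a polyOver L -> g \is a polyOver L ->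
        q = f * g -> (size f <= 1)%N \/ (size g <= 1)%N].

Definition reducible_over (L : divringClosed F) (q : {poly F}) : Prop :=
  exists f g : {poly F},
    [/\ f \is a polyOver L, g \is a polyOver L,
        (1 < size f)%N, (1 < size g)%N & q = f * g].

End Irreducibility.

Section GaloisGroup.
Variable F : fieldType.

(* Only the restriction of [phi] to [E] matters; [phi 1 = 1] follows from
   [1 \in L]. *)
Definition galois_automorphism (L E : divringClosed F) (phi : F -> F) : Prop :=
  [/\ {in E, forall x, phi x \in E},
      {in E &, {morph phi : x y / x + y}},
      {in E &, {morph phi : x y / x * y}},
      {in E &, injective phi} /\
        {in E, forall y, exists2 x, x \in E & phi x = y}
    & {in L, forall x, phi x = x}].

Variables (L : divringClosed F) (n : nat) (r : n.-tuple F).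

(* The permutation [s] of the indices stands for the permutation
   r_i |-> r_(s i) of the roots. *)
Definition galois_perms : {set 'S_n} :=
  [set s : 'S_n |
    `[< exists2 phi : F -> F, galois_automorphism L (adjoin L r) phi
          & forall i : 'I_n, phi (tnth r i) = tnth r (s i) >]].

Lemma galois_perms_group_set : group_set galois_perms.
Proof.
apply/group_setP; split=> [|s t].
  rewrite inE; apply/asboolP; exists id; last by move=> i; rewrite perm1.
  by split=> //; split=> // y yE; exists y.
rewrite !inE => /asboolP[f [fE fD fM [fI fS] fL] fr].
move=> /asboolP[g [gE gD gM [gI gS] gL] gr].
apply/asboolP; exists (g \o f); last by move=> i /=; rewrite fr gr permM.
split=> [x xE|x y xE yE|x y xE yE||x xL] /=.
- by rewrite gE ?fE.
- by rewrite fD // gD ?fE.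
- by rewrite fM // gM ?fE.
- split=> [x y xE yE /gI e|y /gS[z /fS[x xE <-] <-]]; last by exists x.
  by apply: fI => //; apply: e; apply: fE.
- by rewrite fL ?gL.
Qed.

Definition galois_group : {group 'S_n} := Group galois_perms_group_set.

End GaloisGroup.

Section Resolvent.
Variables (F : fieldType) (n : nat).

Definition resolvent_value (a r : n.-tuple F) (s : 'S_n) : F :=
  \sum_(i < n) tnth a i * tnth r (s i).

Definition is_resolvent (K : divringClosed F) (a r : n.-tuple F) : Prop :=
  {subset a <= K} /\ injective (resolvent_value a r).

Definition auxiliary_poly (a r : n.-tuple F) : {poly F} :=
  \prod_(s : 'S_n) ('X - (resolvent_value a r s)%:P).

End Resolvent.

(* Main.v *)
From HB Require Import structures.
From mathcomp Require Import mpoly.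
Require Import Defs.
From mathcomp Require Import all_boot all_order all_algebra.
From mathcomp Require Import all_fingroup all_solvable.
From mathcomp Require Import boolp reals complex.
Import GRing.Theory GroupScope.
Local Open Scope ring_scope.

(** Over a field L containing the coefficients of p and V, Lagrange interpolation
    (whose coefficients are symmetric in the roots, hence in L) gives
    L(r_1, ..., r_n) = L(V_t) for every value V_t of V. Hence the minimal
    polynomial of V_t over L is M_t = prod_(s in Gal_L) (X - V_(t s)).

    All irreducible factors over K of the auxiliary polynomial have degree
    |Gal_K|, those over K(rho) have degree |Gal_K(rho)|, so the reducibility of q
    gives |Gal_K(rho)| < |Gal_K|. Therefore the M_1 of K(rho) cannot lie in K[X],
    and one of its coefficients lies in K(r_1, ..., r_n) and in K(rho) but not in
    K. This makes the degree of rho over K(r_1, ..., r_n) less than the prime l,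
    which forces rho itself into K(r_1, ..., r_n). Now s |-> phi_s(rho) / rho is a
    nontrivial character of Gal_K with values in the l-th roots of unity and
    kernel Gal_K(rho). *)

Set Implicit Arguments.
Unset Strict Implicit.
Unset Printing Implicit Defensive.

(** * Subfields as field types, and polynomials over a subfield *)

Definition subfield_type (F : fieldType) (L : divringClosed F) := {x | x \in L}.

Section SubfieldType.
Variables (F : fieldType) (L : divringClosed F).
HB.instance Definition _ := SubChoice.on (subfield_type L).
HB.instance Definition _ := [SubChoice_isSubComUnitRing of subfield_type L by <:].
HB.instance Definition _ :=
  [SubComUnitRing_isSubIntegralDomain of subfield_type L by <:].
HB.instance Definition _ := [SubIntegralDomain_isSubField of subfield_type L by <:].

Definition subfield_incl (x : subfield_type L) : F := val x.

Fact subfield_incl_is_additive : zmod_morphism subfield_incl.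
Proof. exact: (raddfB (val : {rmorphism subfield_type L -> F})). Qed.

Fact subfield_incl_is_multiplicative : monoid_morphism subfield_incl.
Proof. by []. Qed.

HB.instance Definition _ := GRing.isZmodMorphism.Build _ _ subfield_incl
  subfield_incl_is_additive.
HB.instance Definition _ := GRing.isMonoidMorphism.Build _ _ subfield_incl
  subfield_incl_is_multiplicative.

Lemma subfield_incl_in x : subfield_incl x \in L.
Proof. exact: valP. Qed.

Lemma insubd_inclK c : c \in L -> subfield_incl (insubd 0 c) = c.
Proof. exact: insubdK. Qed.

Local Notation incl := subfield_incl.

Lemma polyOver_lift (f : {poly F}) :
  f \is a polyOver L -> exists f0 : {poly subfield_type L}, f = map_poly incl f0.
Proof.
move=> /polyOverP fL; exists (\poly_(i < size f) (insubd 0 f`_i)).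
apply/polyP => i; rewrite coef_map coef_poly.
case: ltnP => [_|le_i]; last by rewrite nth_default ?rmorph0.
by rewrite /= insubd_inclK.
Qed.

Lemma map_polyOver (f0 : {poly subfield_type L}) : map_poly incl f0 \is a polyOver L.
Proof. by apply/polyOverP => i; rewrite coef_map; apply: subfield_incl_in. Qed.

Lemma polyOver_modp (f g : {poly F}) :
  f \is a polyOver L -> g \is a polyOver L -> f %% g \is a polyOver L.
Proof.
move=> /polyOver_lift[f0 ->] /polyOver_lift[g0 ->].
by rewrite -map_modp map_polyOver.
Qed.

Lemma polyOver_divp (f g : {poly F}) :
  f \is a polyOver L -> g \is a polyOver L -> f %/ g \is a polyOver L.
Proof.
move=> /polyOver_lift[f0 ->] /polyOver_lift[g0 ->].
by rewrite -map_divp map_polyOver.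
Qed.

(** A nonzero polynomial over [L] of least size vanishing at [x], made monic, works: remainders
    modulo it stay over [L], so a remainder vanishing at [x] is zero. *)
Lemma min_poly_over (x : F) (u : {poly F}) :
    u \is a polyOver L -> u != 0 -> root u x ->
  exists m : {poly F}, [/\ m \is a polyOver L, m \is monic, root m x
    & forall g, g \is a polyOver L -> root g x -> m %| g].
Proof.
move=> uL u0 ux.
pose P k := `[< exists m, [/\ m \is a polyOver L, m != 0, root m x & size m = k] >].
have exP : exists k, P k by exists (size u); apply/asboolP; exists u.
case: (ex_minnP exP) => k /asboolP[m [mL m0 mx <-]] min_m.
have c0 : lead_coef m != 0 by rewrite lead_coef_eq0.
exists ((lead_coef m)^-1 *: m); split.
- by rewrite polyOverZ // rpredV; apply: (polyOverP mL).
- by rewrite monicE lead_coefZ mulVf.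
- by rewrite rootZ ?invr_eq0.
move=> g gL gx; rewrite dvdpZl ?invr_eq0 //.
apply: contraT => ndvd; have := ltn_modp g m; rewrite m0 ltnNge => /negP[].
apply/min_m/asboolP; exists (g %% m); split => //; first exact: polyOver_modp.
have := gx; rewrite {1}(divp_eq g m) /root hornerD hornerM.
by rewrite (rootP mx) mulr0 add0r.
Qed.

(** Since [u] may share factors with [f], it is first replaced by its greatest divisor coprime to
    [f], which keeps the root [x] because [f.[x] != 0]. A Bezout relation evaluated at [x] then
    gives the inverse. *)
Lemma inv_poly_over (x : F) (u f : {poly F}) :
    u \is a polyOver L -> u != 0 -> root u x ->
    f \is a polyOver L -> f.[x] != 0 ->
  exists2 g, g \is a polyOver L & g.[x] = f.[x]^-1.
Proof.
move=> /polyOver_lift[u0 ->] nz ux /polyOver_lift[f0 ->] fx.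
have u0nz : u0 != 0 by apply: contraNneq nz => ->; rewrite rmorph0.
have /Bezout_coprimepP[[b c] /= e] : coprimep f0 (gdcop f0 u0).
  by rewrite coprimep_sym coprimep_gdco.
have wx : (map_poly incl (gdcop f0 u0)).[x] = 0.
  by apply/rootP; rewrite gdcop_map root_gdco // ux.
have /eqpP[[d1 d2] /= /andP[d10 d20] e2] := e.
exists (map_poly incl (d2^-1 *: (d1 *: b))); first exact: map_polyOver.
apply: (mulIf fx); rewrite mulVf //.
have : (map_poly incl (d2^-1 *: (d1 *: (b * f0 + c * gdcop f0 u0)))).[x] = 1.
  by rewrite e2 scalerA mulVf // scale1r rmorph1 hornerE.
by rewrite !scalerDr !scalerAl rmorphD !rmorphM hornerD !hornerM wx mulr0 addr0.
Qed.

End SubfieldType.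
Arguments subfield_incl : simpl never.

(** * Generated subfields and their automorphisms *)

Section Adjoin.
Variables (F : fieldType).

Lemma adjoin_base (L : divringClosed F) s : {subset L <= adjoin L s}.
Proof. by move=> x xL; apply/asboolP => M LM _; apply: LM. Qed.

Lemma adjoin_gen (L : divringClosed F) s : {subset s <= adjoin L s}.
Proof. by move=> x xL; apply/asboolP => M _; apply. Qed.

(** Induction principle for generated fields: the elements satisfying [P] form a subfield, one of
    those intersected in [adjoin L s]. *)
Lemma adjoin_min (L : divringClosed F) s (P : F -> Prop) :
    {in L, forall x, P x} -> {in s, forall x, P x} ->
    (forall x y, P x -> P y -> P (x - y)) ->
    (forall x y, P x -> P y -> P (x * y)) ->
    (forall x, P x -> P x^-1) ->
  {in adjoin L s, forall x, P x}.
Proof.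
move=> PL Ps PB PM PV x /asboolP xE.
pose A : {pred F} := [pred x | `[< P x >]].
have cl : divring_closed A.
  split=> [|y z /asboolP Py /asboolP Pz|y z /asboolP Py /asboolP Pz]; apply/asboolP.
  - by apply: PL; apply: rpred1.
  - exact: PB.
  - by apply: PM => //; apply: PV.
pose C : divringClosed F := HB.pack A (GRing.isDivringClosed.Build F A cl).
by apply/asboolP/(xE C) => y yP; apply/asboolP; [apply: PL|apply: Ps].
Qed.

Lemma galois_automorphism_eq (L E E' : divringClosed F) phi :
  E =i E' -> galois_automorphism L E phi -> galois_automorphism L E' phi.
Proof.
move=> eE [h1 h2 h3 [h4 h5] h6]; split=> //.
- by move=> x; rewrite -!eE; apply: h1.
- by move=> x y; rewrite -!eE; apply: h2.
- by move=> x y; rewrite -!eE; apply: h3.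
- split=> [x y|y]; rewrite -?eE; first exact: h4.
  by move=> /h5[x xE <-]; exists x => //; rewrite -eE.
Qed.

Lemma galois_automorphism_horner (L E : divringClosed F) phi :
    {subset L <= E} -> galois_automorphism L E phi ->
  {in E, forall x f, f \is a polyOver L -> phi f.[x] = f.[phi x]}.
Proof.
move=> LE [_ hD hM _ hL] x xE; elim/poly_ind => [_|f c IH fcL].
  by rewrite !horner0 hL ?rpred0.
have fL : f \is a polyOver L.
  apply/polyOverP => i; have /polyOverP/(_ i.+1) := fcL.
  by rewrite coefD coefMX coefC addr0.
have cL : c \in L.
  by have /polyOverP/(_ 0) := fcL; rewrite coefD coefMX coefC add0r.
have fxE : f.[x] \in E by rewrite rpred_horner //; apply: polyOverS fL.
by rewrite !hornerMXaddC hD ?hM ?(hL c) ?IH //; [apply: rpredM|apply: LE].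
Qed.

End Adjoin.

(** * Symmetric expressions in the roots *)

Section SymmetricExpressions.
Variables (F : fieldType) (L : divringClosed F) (n : nat) (r : n.-tuple F).
Hypothesis r_over : \prod_(x <- r) ('X - x%:P) \is a polyOver L.

Local Notation incl := (@subfield_incl F L).
Local Notation ev := (mmap incl (tnth r)).

(** By Vieta these values are, up to sign, coefficients of the product of the ['X - x%:P]; for
    [n < k] the defining sum is empty. *)
Lemma mesym_eval_in k : (mesym n F k).@[tnth r] \in L.
Proof.
have [le_k|lt_k] := leqP k n; last first.
  rewrite mesymE big_pred0 ?meval0 ?rpred0 // => h; apply: contraTF lt_k => /eqP <-.
  by rewrite -leqNgt -[X in (_ <= X)%N](card_ord n) max_card.
have := polyOverP r_over (n - k)%N.
have := mroots_coeff r (Ordinal (le_k : (k < n.+1)%N)) => /= ->.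
by move/(rpredM (rpredX k (rpredN1 L))); rewrite mulrA -expr2 sqrr_sign mul1r.
Qed.

(** By the fundamental theorem, [p] is a polynomial over [L] in the elementary symmetric ones, whose
    values at the roots lie in [L]. *)
Lemma mmap_symmetric_in (p : {mpoly (subfield_type L)[n]}) :
  p \is @mpoly.symmetric n (subfield_type L) -> ev p \in L.
Proof.
case/sym_fundamental => t [<- _]; rewrite comp_mpolyEX rmorph_sum rpred_sum // => m _.
rewrite /= mmapZ rpredM ?subfield_incl_in // comp_mpolyX rmorph_prod rpred_prod // => i _.
rewrite rmorphXn rpredX // tnth_mktuple /=.
suff -> : ev (mesym n (subfield_type L) i.+1) = (mesym n F i.+1).@[tnth r].
  exact: mesym_eval_in.
rewrite !rmorph_sum; apply: eq_bigr => h _; rewrite !rmorph_prod.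
by apply: eq_bigr => j _; rewrite /= mevalXU mmapX mmap1U.
Qed.

Lemma map_poly_symmetric_over (f : {poly {mpoly (subfield_type L)[n]}}) :
  (forall s, map_poly (msym s) f = f) -> map_poly ev f \is a polyOver L.
Proof.
move=> sym_f; apply/polyOverP => i; rewrite coef_map /=.
by apply/mmap_symmetric_in/issymP => s; rewrite -[in RHS](sym_f s) coef_map.
Qed.

Variable a : n.-tuple F.
Hypothesis a_in : {subset a <= L}.

Local Notation V := (resolvent_value a r).

(** Lagrange interpolation of the values [c s] at the nodes [V s], without the denominators, so that
    no division by expressions in the roots occurs. The value at [V s] is thus [c s] times the
    derivative of the auxiliary polynomial there. *)
Definition lagrange_poly (c : 'S_n -> F) : {poly F} :=
  \sum_s (c s)%:P * \prod_(u | u != s) ('X - (V u)%:P).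

Lemma horner_lagrange_poly c s :
  (lagrange_poly c).[V s] = c s * \prod_(u | u != s) (V s - V u).
Proof.
rewrite horner_sum (bigD1 s) //= [X in _ + X]big1 => [|t ne_ts].
  rewrite addr0 hornerM hornerC horner_prod; congr (_ * _).
  by apply: eq_bigr => u _; rewrite !hornerE.
by rewrite hornerM horner_prod (bigD1 s) 1?eq_sym //= hornerXsubC subrr mul0r mulr0.
Qed.

(** The resolvent with indeterminates in place of the roots: every permutation acts on it, even one
    that no automorphism induces. The default 0 of [insubd] never occurs, as [a] lies in [L]. *)
Definition generic_value (s : 'S_n) : {mpoly (subfield_type L)[n]} :=
  \sum_(i < n) (insubd (0 : subfield_type L) (tnth a i))%:MP * 'X_(s i).

Lemma mmap_generic_value s : ev (generic_value s) = V s.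
Proof.
rewrite rmorph_sum; apply: eq_bigr => i _; rewrite rmorphM /= mmapC mmapX mmap1U.
by rewrite /= insubd_inclK // a_in ?mem_tnth.
Qed.

Lemma msym_generic_value t s : msym t (generic_value s) = generic_value (s * t)%g.
Proof.
rewrite rmorph_sum; apply: eq_bigr => i _; rewrite rmorphM /= /msym mmapC mmapX mmap1U.
by rewrite permM.
Qed.

(** Before evaluation, permuting the indeterminates by [t] only reindexes the sum and the products
    by [s |-> s * t], so all coefficients are symmetric. *)
Lemma lagrange_poly_over (c : 'S_n -> {mpoly (subfield_type L)[n]}) :
    (forall s t, msym t (c s) = c (s * t)%g) ->
  lagrange_poly (fun s => ev (c s)) \is a polyOver L.
Proof.
move=> sym_c.
have -> : lagrange_poly (fun s => ev (c s)) =
    map_poly ev (\sum_s (c s)%:P * \prod_(u | u != s) ('X - (generic_value u)%:P)).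
  rewrite rmorph_sum; apply: eq_bigr => s _; rewrite rmorphM rmorph_prod /= map_polyC.
  by congr (_ * _); apply: eq_bigr => u _;
    rewrite rmorphB /= map_polyX map_polyC /= mmap_generic_value.
apply: map_poly_symmetric_over => t.
rewrite [RHS](reindex_inj (mulIg t)) rmorph_sum; apply: eq_bigr => s _.
rewrite rmorphM rmorph_prod /= map_polyC /= sym_c; congr (_ * _).
rewrite [RHS](reindex_inj (mulIg t)); apply: eq_big => u; first by rewrite (inj_eq (mulIg t)).
by rewrite rmorphB /= map_polyX map_polyC /= msym_generic_value.
Qed.

Lemma auxiliary_poly_over : auxiliary_poly a r \is a polyOver L.
Proof.
have -> : auxiliary_poly a r = map_poly ev (\prod_s ('X - (generic_value s)%:P)).
  rewrite rmorph_prod; apply: eq_bigr => s _.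
  by rewrite rmorphB /= map_polyX map_polyC /= mmap_generic_value.
apply: map_poly_symmetric_over => t.
rewrite [RHS](reindex_inj (mulIg t)) rmorph_prod; apply: eq_bigr => s _.
by rewrite rmorphB /= map_polyX map_polyC /= msym_generic_value.
Qed.

End SymmetricExpressions.

(** * The Galois group acting on the values of the resolvent *)

Section GaloisResolvent.
Variables (F : fieldType) (L : divringClosed F) (n : nat) (r : n.-tuple F).
Hypothesis r_over : \prod_(x <- r) ('X - x%:P) \is a polyOver L.
Variable a : n.-tuple F.
Hypothesis a_resolvent : is_resolvent L a r.

Local Notation V := (resolvent_value a r).
Local Notation E := (adjoin L r).

Let a_in : {subset a <= L} := a_resolvent.1.
Let V_inj : injective V := a_resolvent.2.

Lemma tnth_adjoin i : tnth r i \in E.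
Proof. by apply: adjoin_gen; apply: mem_tnth. Qed.

Lemma resolvent_value_adjoin s : V s \in E.
Proof.
apply: rpred_sum => i _; apply: rpredM; last exact: tnth_adjoin.
by apply: adjoin_base; apply: a_in; apply: mem_tnth.
Qed.

Lemma horner_adjoin (f : {poly F}) x : f \is a polyOver L -> x \in E -> f.[x] \in E.
Proof.
by move=> fL xE; rewrite rpred_horner //; apply: polyOverS fL; apply: adjoin_base.
Qed.

Lemma auxiliary_poly_neq0 : auxiliary_poly a r != 0.
Proof. by apply/prodf_neq0 => s _; rewrite polyXsubC_eq0. Qed.

Lemma root_auxiliary_poly t : root (auxiliary_poly a r) (V t).
Proof. by rewrite /auxiliary_poly (bigD1 t) //= rootM root_XsubC eqxx. Qed.

Lemma resolvent_diff_neq0 t : \prod_(u | u != t) (V t - V u) != 0.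
Proof.
apply/prodf_neq0 => u; apply: contraNneq => /eqP.
by rewrite subr_eq0 eq_sym (inj_eq V_inj).
Qed.

(* Lagrange's interpolation: the coefficients are symmetric in the roots. *)
Lemma root_fraction i :
  exists f g : {poly F}, [/\ f \is a polyOver L, g \is a polyOver L
  & forall t, g.[V t] != 0 /\ f.[V t] = tnth r (t i) * g.[V t]].
Proof.
(* Two interpolations, of the roots [r_(s i)] and of the constant 1; their missing denominators
   cancel in the quotient. *)
exists (lagrange_poly r a (fun s => mmap (@subfield_incl F L) (tnth r) 'X_(s i))).
exists (lagrange_poly r a (fun=> mmap (@subfield_incl F L) (tnth r) 1)).
split=> [||t].
- by apply: lagrange_poly_over => // s t; rewrite /msym mmapX mmap1U permM.
- by apply: lagrange_poly_over => // s t; rewrite rmorph1.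
by rewrite !horner_lagrange_poly // rmorph1 mul1r resolvent_diff_neq0 mmapX mmap1U.
Qed.

(** The polynomial expressions in [V t] already form a field, because [V t] is algebraic over [L],
    and [root_fraction] puts every root into it. *)
Lemma adjoin_horner t :
  {in E, forall x, exists2 f : {poly F}, f \is a polyOver L & x = f.[V t]}.
Proof.
have inv f : f \is a polyOver L ->
    exists2 g : {poly F}, g \is a polyOver L & g.[V t] = f.[V t]^-1.
  move=> fL; have [f0|f0] := eqVneq f.[V t] 0.
    by exists 0; rewrite ?rpred0 // f0 invr0 horner0.
  exact: inv_poly_over (auxiliary_poly_over r_over a_in) auxiliary_poly_neq0
    (root_auxiliary_poly t) fL f0.
apply: adjoin_min => [x xL|_ /tnthP[i ->]|_ _ [f fL ->] [g gL ->]|_ _ [f fL ->] [g gL ->]|].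
- by exists x%:P; rewrite ?polyOverC ?hornerC.
  have [f' [g' [f'L g'L /(_ t)[nz eq]]]] := root_fraction ((t^-1)%g i).
  have [h hL he] := inv g' g'L.
  by exists (f' * h); rewrite ?rpredM // hornerM eq he mulfK // permKV.
- by exists (f - g); rewrite ?rpredB // hornerD hornerN.
- by exists (f * g); rewrite ?rpredM // hornerM.
- by move=> _ [f fL ->]; have [g gL <-] := inv f fL; exists g.
Qed.

Lemma galois_automorphism_value (phi : F -> F) (s : 'S_n) t :
    galois_automorphism L E phi -> (forall i, phi (tnth r i) = tnth r (s i)) ->
  phi (V t) = V (t * s)%g.
Proof.
move=> [_ phiD phiM _ phiL] phi_r.
(* Membership in [E] is carried through the sum because [phi] is a morphism only on [E]. *)
suff [_] : V t \in E /\ phi (V t) = V (t * s)%g by [].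
rewrite /resolvent_value.
apply: (big_rec2 (fun x y => x \in E /\ phi x = y)) => [|i x _ _ [xE <-]].
  by rewrite rpred0 phiL ?rpred0.
have aL : tnth a i \in L by apply: a_in; apply: mem_tnth.
have aE := adjoin_base r aL; have rE := tnth_adjoin (t i).
by rewrite rpredD ?rpredM // phiD ?rpredM // phiM // phiL // phi_r permM.
Qed.

Lemma galois_automorphism_horner_value (phi : F -> F) (s : 'S_n) t (f : {poly F}) :
    galois_automorphism L E phi -> (forall i, phi (tnth r i) = tnth r (s i)) ->
    f \is a polyOver L ->
  phi f.[V t] = f.[V (t * s)%g].
Proof.
move=> phiA phi_r fL; rewrite (galois_automorphism_horner _ phiA) //.
- by rewrite (galois_automorphism_value _ phiA phi_r).
- exact: adjoin_base.
- exact: resolvent_value_adjoin.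
Qed.

Lemma galois_perms_root s t (f : {poly F}) : s \in galois_perms L r ->
  f \is a polyOver L -> root f (V t) -> root f (V (t * s)%g).
Proof.
rewrite inE => /asboolP[phi phiA phi_r] fL /rootP ft; apply/rootP.
rewrite -(galois_automorphism_horner_value t phiA phi_r fL) ft.
by case: phiA => _ _ _ _ ->; rewrite ?rpred0.
Qed.

(** The automorphism is [f.[V t] |-> f.[V s]], well defined because every relation over [L]
    satisfied by [V t] holds for [V s]. *)
Lemma conjugate_galois_perms s t :
    (forall f : {poly F}, f \is a polyOver L -> root f (V t) -> root f (V s)) ->
  (t^-1 * s)%g \in galois_perms L r.
Proof.
move=> conj.
(* A polynomial [h x] representing each [x] of [E] is chosen; [phiE] shows that the choice does not
   matter. *)
have /choice[h hP] : forall x, exists f : {poly F},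
    x \in E -> f \is a polyOver L /\ x = f.[V t].
  move=> x; case: (boolP (x \in E)) => [/(adjoin_horner t)[f fL ->]|_]; last by exists 0.
  by exists f.
pose phi x := (h x).[V s].
have phiE f : f \is a polyOver L -> phi f.[V t] = f.[V s].
  move=> fL; have [gL ge] := hP _ (horner_adjoin fL (resolvent_value_adjoin t)).
  apply/eqP; rewrite -subr_eq0 -hornerN -hornerD; apply: conj; first exact: rpredB.
  by rewrite /root hornerD hornerN -ge subrr.
have phiL x : x \in L -> phi x = x.
  by move=> xL; have := phiE x%:P; rewrite !hornerC polyOverC; apply.
have phiD : {in E &, {morph phi : x y / x + y}}.
  move=> _ _ /(adjoin_horner t)[f fL ->] /(adjoin_horner t)[g gL ->].
  by rewrite -hornerD !phiE ?rpredD // hornerD.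
have phiM : {in E &, {morph phi : x y / x * y}}.
  move=> _ _ /(adjoin_horner t)[f fL ->] /(adjoin_horner t)[g gL ->].
  by rewrite -hornerM !phiE ?rpredM // hornerM.
have phi_in : {in E, forall x, phi x \in E}.
  move=> _ /(adjoin_horner t)[f fL ->]; rewrite phiE //.
  exact/horner_adjoin/resolvent_value_adjoin.
have phi_r i : phi (tnth r i) = tnth r ((t^-1 * s)%g i).
  (* The same fraction gives [r_i] at [V t] and the required image at [V s]. *)
  have [f [g [fL gL fg]]] := root_fraction ((t^-1)%g i).
  have [[gt ft] [gs fs]] := (fg t, fg s).
  apply: (mulIf gs); rewrite permM -fs -(phiE _ gL) -phiM ?tnth_adjoin //.
    by rewrite -(phiE _ fL) ft permKV.
  exact/horner_adjoin/resolvent_value_adjoin.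
have phi_inj0 x : x \in E -> phi x = 0 -> x = 0.
  move=> xE phi0; apply/eqP; apply: contraT => x0.
  have := phiM _ _ xE (rpredVr xE); rewrite phi0 mul0r divff // phiL ?rpred1 //.
  by move/eqP; rewrite oner_eq0.
rewrite inE; apply/asboolP; exists phi => //; split=> //; split.
  move=> x y xE yE e; apply/eqP; rewrite -subr_eq0; apply/eqP/phi_inj0; rewrite ?rpredB //.
  apply: (addIr (phi y)); rewrite -phiD ?rpredB // subrK add0r //.
(* Surjectivity: the image of [phi] is a field containing [L] and, since [phi] permutes the roots,
   all of them. *)
apply: adjoin_min =>
  [x xL|_ /tnthP[i ->]|_ _ [x xE <-] [y yE <-]|_ _ [x xE <-] [y yE <-]|_ [x xE <-]].
- by exists x; [apply: adjoin_base | apply: phiL].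
- exists (tnth r ((t^-1 * s)^-1%g i)); first exact: tnth_adjoin.
  by rewrite phi_r permKV.
- exists (x - y); first exact: rpredB.
  by apply: (addIr (phi y)); rewrite -phiD ?rpredB // !subrK.
- by exists (x * y); [apply: rpredM | apply: phiM].
exists x^-1; first exact: rpredVr.
have [->|x0] := eqVneq x 0; first by rewrite invr0 !phiL ?rpred0 // invr0.
have nz : phi x != 0 by apply: contraNneq x0 => /(phi_inj0 _ xE) ->.
by apply: (mulIf nz); rewrite -phiM ?rpredVr // !mulVf // phiL ?rpred1.
Qed.

Definition galois_orbit_poly t : {poly F} :=
  \prod_(s in galois_perms L r) ('X - (V (t * s)%g)%:P).

Lemma galois_orbit_poly_dvd t g : g \is a polyOver L -> root g (V t) ->
  galois_orbit_poly t %| g.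
Proof.
move=> gL gt; rewrite /galois_orbit_poly -big_enum /=.
rewrite -(big_map (fun s => V (t * s)%g) xpredT (fun z => 'X - z%:P)).
apply: uniq_roots_dvdp.
  by apply/allP => _ /mapP[s + ->]; rewrite mem_enum => sG; apply: galois_perms_root.
by rewrite uniq_rootsE map_inj_uniq ?enum_uniq // => s u /V_inj /mulgI.
Qed.

Lemma size_galois_orbit_poly t : size (galois_orbit_poly t) = #|galois_perms L r|.+1.
Proof. by rewrite /galois_orbit_poly -big_enum size_prod_XsubC -cardE. Qed.

Lemma root_galois_orbit_poly t u :
  root (galois_orbit_poly t) (V u) = ((t^-1 * u)%g \in galois_perms L r).
Proof.
rewrite /galois_orbit_poly -big_enum /=.
rewrite -(big_map (fun s => V (t * s)%g) xpredT (fun z => 'X - z%:P)) root_prod_XsubC.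
apply/mapP/idP => [[s + /V_inj ->]|uG]; first by rewrite mem_enum mulKg.
by exists (t^-1 * u)%g; rewrite ?mem_enum ?mulKVg.
Qed.

(** It equals the minimal polynomial [m] of [V t]: [m] divides the auxiliary polynomial, so it is a
    product of distinct linear factors, and each of its roots [V u] is a conjugate of [V t], hence
    in the Galois orbit. *)
Lemma galois_orbit_poly_over t : galois_orbit_poly t \is a polyOver L.
Proof.
have auxL := auxiliary_poly_over r_over a_in.
have [m [mL m1 mt m_min]] :=
  min_poly_over auxL auxiliary_poly_neq0 (root_auxiliary_poly t).
suff -> : galois_orbit_poly t = m by [].
apply/eqP; rewrite -eqp_monic ?monic_prod_XsubC //; apply/andP; split.
  exact: galois_orbit_poly_dvd.
have := m_min _ auxL (root_auxiliary_poly t).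
rewrite /auxiliary_poly => /dvdp_prod_XsubC[b mE].
rewrite (eqp_dvdl _ mE) -(big_map V xpredT (fun z => 'X - z%:P)).
apply: uniq_roots_dvdp; last first.
  by rewrite uniq_rootsE map_inj_uniq ?mask_uniq ?index_enum_uniq.
apply/allP => _ /mapP[u ub ->]; rewrite root_galois_orbit_poly.
apply: conjugate_galois_perms => f fL ft.
rewrite -dvdp_XsubCl; apply: dvdp_trans (m_min f fL ft); rewrite dvdp_XsubCl (eqp_root mE).
by rewrite -(big_map V xpredT (fun z => 'X - z%:P)) root_prod_XsubC map_f.
Qed.

End GaloisResolvent.

(** * Radicals of prime degree *)

Section Radicals.
Variable F : fieldType.

Lemma adjoin_sub (L : divringClosed F) s (E : divringClosed F) :
  {subset L <= E} -> {subset s <= E} -> {subset adjoin L s <= E}.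
Proof. by move=> LE sE x /asboolP; apply. Qed.

(** The polynomials in [rho] form a field since [rho] is algebraic over [K]; reducing modulo
    ['X^l - A%:P] bounds the size. *)
Lemma adjoin_radical_horner (K : divringClosed F) l (A rho : F) :
    (0 < l)%N -> A \in K -> rho ^+ l = A ->
  {in adjoin K [:: rho], forall x, exists f : {poly F},
    [/\ f \is a polyOver K, (size f <= l)%N & x = f.[rho]]}.
Proof.
move=> l_gt0 AK rhoA x xE.
have uK : 'X^l - A%:P \is a polyOver K by rewrite rpredB ?polyOverXn ?polyOverC.
have u0 : 'X^l - A%:P != 0 by rewrite -size_poly_eq0 size_XnsubC.
have ur : root ('X^l - A%:P) rho by rewrite /root !hornerE rhoA subrr.
suff [f fK ->] : exists2 f, f \is a polyOver K & x = f.[rho].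
  exists (f %% ('X^l - A%:P)); split; first exact: polyOver_modp.
    by rewrite -ltnS -(size_XnsubC A l_gt0) ltn_modp.
  by rewrite {1}(divp_eq f ('X^l - A%:P)) hornerD hornerM (rootP ur) mulr0 add0r.
move: x xE; apply: adjoin_min =>
  [x xK|x|_ _ [f fL ->] [g gL ->]|_ _ [f fL ->] [g gL ->]|_ [f fL ->]].
- by exists x%:P; rewrite ?polyOverC ?hornerC.
- by rewrite inE => /eqP ->; exists 'X; rewrite ?polyOverX ?hornerX.
- by exists (f - g); rewrite ?rpredB // hornerD hornerN.
- by exists (f * g); rewrite ?rpredM // hornerM.
have [f0|f0] := eqVneq f.[rho] 0; first by exists 0; rewrite ?rpred0 // f0 invr0 horner0.
by have [g gK ge] := inv_poly_over uK u0 ur fL f0; exists g.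
Qed.

End Radicals.

(* The constant coefficient of the minimal polynomial of [rho] over [E] is, up to
   sign and a root of unity, [rho ^+ d] with [0 < d < l]. *)
Lemma prime_radical_in (F : closedFieldType) (E : divringClosed F) l (rho : F)
    (g : {poly F}) :
    prime l -> (forall z : F, z ^+ l = 1 -> z \in E) -> rho ^+ l \in E ->
    g \is a polyOver E -> g != 0 -> root g rho -> (size g <= l)%N ->
  rho \in E.
Proof.
move=> l_pr unityE AE gE g0 grho size_g.
have [->|rho0] := eqVneq rho 0; first exact: rpred0.
have l_gt0 := prime_gt0 l_pr.
have [m [mE m1 mrho m_min]] := min_poly_over gE g0 grho.
have uE : 'X^l - (rho ^+ l)%:P \is a polyOver E by rewrite rpredB ?polyOverXn ?polyOverC.
have m_dvd : m %| 'X^l - (rho ^+ l)%:P.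
  by apply: m_min; rewrite // /root !hornerE subrr.
have [rs def_m] := closed_field_poly_normal m.
rewrite (monicP m1) scale1r in def_m.
have size_m : size m = (size rs).+1 by rewrite def_m size_prod_XsubC.
have rs_gt0 : (0 < size rs)%N.
  by move: mrho; rewrite def_m root_prod_XsubC; case: (rs).
have rs_lt : (size rs < l)%N.
  by rewrite -size_m (leq_trans _ size_g) // dvdp_leq // m_min.
have rs_l z : z \in rs -> z ^+ l = rho ^+ l.
  move=> zrs; apply/eqP; rewrite -subr_eq0.
  have : root ('X^l - (rho ^+ l)%:P) z.
    rewrite -dvdp_XsubCl (dvdp_trans _ m_dvd) //.
    by rewrite dvdp_XsubCl def_m root_prod_XsubC.
  by rewrite /root !hornerE.
have rho_d : rho ^+ size rs \in E.
  have : \prod_(z <- rs) (z / rho) \in E.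
    rewrite big_seq rpred_prod // => z zrs; apply: unityE.
    by rewrite expr_div_n rs_l // divff // expf_neq0.
  rewrite big_split /= big_const_seq count_predT iter_mulr_1 exprVn.
  have m0 : \prod_(z <- rs) z \in E.
    have := polyOverP mE 0; rewrite -horner_coef0 def_m horner_prod.
    rewrite (eq_bigr (fun z => -1 * z)) => [|z _]; last by rewrite hornerXsubC mulN1r sub0r.
    rewrite big_split /= big_const_seq count_predT iter_mulr_1.
    by move/(rpredM (rpredX (size rs) (rpredN1 E))); rewrite mulrA -expr2 sqrr_sign mul1r.
  have nz : \prod_(z <- rs) z != 0.
    rewrite prodf_seq_neq0; apply/allP => z /rs_l zl /=.
    by apply: contraNneq (expf_neq0 l rho0) => z0; rewrite -zl z0 expr0n gtn_eqF.
  by move/(rpred_div m0); rewrite invfM invrK mulVKf.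
(* Bezout: [size rs] lies strictly between 0 and the prime [l], so it is coprime to [l]. *)
have [u [v uv]] : exists u v, (u * size rs = v * l + 1)%N.
  case: (egcdnP l rs_gt0) => u v e _; exists u, v.
  rewrite e; congr (_ + _)%N; apply/eqP; rewrite -/(coprime _ _) coprime_sym.
  by rewrite prime_coprime // gtnNdvd.
have -> : rho = (rho ^+ size rs) ^+ u / (rho ^+ l) ^+ v.
  rewrite -!exprM [(size rs * u)%N]mulnC uv mulnC exprD mulrAC.
  by rewrite divff ?mul1r ?expr1 // expf_neq0.
by apply: rpred_div; apply: rpredX.
Qed.

(** * Characters of prime order *)

(** [H] is the kernel of the character [zeta]. Any [s] of [G] outside [H] has a primitive [l]-th
    root of unity as its value, so every other value is a power of it and the coset of [s] generates
    the quotient. *)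
Lemma prime_character_quotient (gT : finGroupType) (G H : {group gT}) (F : fieldType)
    (zeta : gT -> F) (l : nat) :
    prime l -> {in G &, {morph zeta : s t / (s * t)%g >-> s * t}} ->
    {in G, forall s, zeta s ^+ l = 1} ->
    (forall s, (s \in H) = (s \in G) && (zeta s == 1)) -> ~~ (G \subset H) ->
  [/\ H <| G, cyclic (G / H)%g & #|(G / H)%g| = l].
Proof.
move=> l_pr zM zl inH /subsetPn[s sG sH].
have HG : H \subset G by apply/subsetP => x; rewrite inH => /andP[].
have z1 : zeta 1%g = 1 by have := group1 H; rewrite inH => /andP[_ /eqP].
have nHG : H <| G.
  apply/andP; split=> //; apply/subsetP => x xG; rewrite inE.
  apply/subsetP => _ /imsetP[h hH ->].
  have hG := subsetP HG h hH; move: hH; rewrite !inH hG groupJ //= => /eqP zh.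
  by rewrite conjgE !zM ?groupM ?groupV // zh mul1r -zM ?groupV // mulVg z1.
have zX x i : x \in G -> zeta (x ^+ i)%g = zeta x ^+ i.
  by move=> xG; elim: i => [|i IH]; rewrite ?expg0 ?z1 // expgS exprS zM ?groupX // IH.
have prim : l.-primitive_root (zeta s).
  have [m pm dvd_m] := prim_order_exists (prime_gt0 l_pr) (zl s sG).
  have /primeP[_ /(_ m dvd_m)/orP[]/eqP e] := l_pr; last by rewrite -e.
  by case/negP: sH; rewrite inH sG -[zeta s]expr1 -e (prim_expr_order pm) eqxx.
have zs0 : zeta s != 0.
  by apply: contra_eq_neq (zl s sG) => ->; rewrite expr0n gtn_eqF ?prime_gt0 // eq_sym oner_eq0.
have nsH : s \in 'N(H)%g by apply: subsetP (normal_norm nHG) s sG.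
have gen : (G / H)%g = <[coset H s]>%g.
  apply/eqP; rewrite eqEsubset cycle_subG mem_quotient // andbT.
  apply/subsetP => _ /morphimP[t nt tG ->].
  have [i e] := prim_rootP prim (zl t tG).
  suff e2 : coset H t = (coset H s ^+ i)%g by rewrite /= e2 mem_cycle.
  rewrite -morphX //; apply/rcoset_kercosetP; rewrite ?groupX // mem_rcoset inH.
  rewrite groupM ?groupV ?groupX //=.
  have := zM (t * (s ^+ i)^-1)%g (s ^+ i)%g.
  rewrite mulgKV zX // e groupM ?groupV ?groupX // => /(_ isT isT)/eqP.
  by rewrite -[X in X == _]mul1r eq_sym (inj_eq (mulIf (expf_neq0 i zs0))).
split=> //; first by rewrite gen cycle_cyclic.
rewrite gen -orderE; have : (#[coset H s]%g %| l)%N.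
  rewrite order_dvdn -morphX //; apply/eqP/coset_id.
  by rewrite inH groupX //= zX // zl.
case/primeP: l_pr => _ dl /dl/orP[]/eqP // /eqP; rewrite order_eq1 => /eqP e.
by case/negP: sH; apply: coset_idr.
Qed.

(** * Enlarging the ground field *)

Section GroundFieldExtension.
Variables (F : closedFieldType) (K L : divringClosed F) (n : nat) (r a : n.-tuple F).
Hypothesis sKL : {subset K <= L}.
Hypothesis r_over : \prod_(x <- r) ('X - x%:P) \is a polyOver K.
Hypothesis a_resolvent : is_resolvent K a r.

Local Notation V := (resolvent_value a r).

Let r_overL : \prod_(x <- r) ('X - x%:P) \is a polyOver L.
Proof. exact: polyOverS r_over. Qed.

Let a_resolventL : is_resolvent L a r.
Proof. by case: a_resolvent => aK V_inj; split=> // x /aK/sKL. Qed.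

(** Let [V t] be a root of [q]. Irreducibility bounds the degree of [q] by the order over [K]; over
    [L], the factor vanishing at [V t] has degree at least the order over [L], and the other factor
    adds at least 1. *)
Lemma card_galois_perms_reducible (q : {poly F}) :
    irreducible_over K q -> q %| auxiliary_poly a r -> reducible_over L q ->
  (#|galois_perms L r| < #|galois_perms K r|)%N.
Proof.
case=> qK size_q q_irr q_aux [f [g [fL gL size_f size_g q_fg]]].
have q0 : q != 0 by rewrite -size_poly_gt0 (ltn_trans _ size_q).
have /closed_rootP[x qx] : size q != 1 by rewrite neq_ltn size_q orbT.
have [t def_x] : exists t, x = V t.
  have : root (auxiliary_poly a r) x.
    by rewrite -dvdp_XsubCl (dvdp_trans _ q_aux) // dvdp_XsubCl.
  rewrite /auxiliary_poly -(big_map V xpredT (fun z => 'X - z%:P)) root_prod_XsubC.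
  by case/mapP => t _ ->; exists t.
rewrite {x}def_x in qx.
have size_q_le : (size q <= #|galois_perms K r|.+1)%N.
  have M_dvd := galois_orbit_poly_dvd a_resolvent qK qx.
  have MK := galois_orbit_poly_over r_over a_resolvent t.
  have q_M := divpK M_dvd; set h := q %/ _ in q_M.
  case: (q_irr _ _ (polyOver_divp qK MK) MK (esym q_M)) => [size_h|].
    rewrite -q_M (leq_trans (size_polyMleq _ _)) // size_galois_orbit_poly addnS /=.
    by rewrite -add1n leq_add2r.
  rewrite size_galois_orbit_poly ltnS leqn0 => /eqP G0.
  by have := cardG_gt0 (galois_group K r); rewrite /= G0.
have size_factor h : h \is a polyOver L -> h != 0 -> root h (V t) ->
    (#|galois_perms L r| < size h)%N.
  move=> hL h0 ht; rewrite -(size_galois_orbit_poly L r a t).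
  exact/dvdp_leq/galois_orbit_poly_dvd.
have f0 : f != 0 by rewrite -size_poly_gt0 (ltn_trans _ size_f).
have g0 : g != 0 by rewrite -size_poly_gt0 (ltn_trans _ size_g).
move: size_q_le; rewrite q_fg size_mul // -ltnS prednK ?addn_gt0 ?size_poly_gt0 ?f0 // => le_fg.
rewrite -2!ltnS (leq_trans _ le_fg) //.
move: qx; rewrite q_fg rootM => /orP[/(size_factor _ fL f0)|/(size_factor _ gL g0)] lt_H.
  by rewrite -addn2 leq_add.
by rewrite addnC -addn2 leq_add.
Qed.

(** If [M] were over [K], each [s] in the group over [K] would send its root [V 1] to a root [V s],
    and the roots of [M] are indexed by the group over [L]. *)
Lemma galois_perms_new_element :
    ~~ (galois_perms K r \subset galois_perms L r) ->
  exists y, [/\ y \in adjoin K r, y \in L & y \notin K].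
Proof.
move=> not_sub; set M := galois_orbit_poly L r a 1%g.
have ML : M \is a polyOver L := galois_orbit_poly_over r_overL a_resolventL 1%g.
have ME : M \is a polyOver (adjoin K r).
  apply: rpred_prod => s _; rewrite polyOverXsubC.
  exact: resolvent_value_adjoin.
have : ~~ (M \is a polyOver K).
  apply: contra not_sub => MK; apply/subsetP => s sG.
  have := galois_perms_root (t := 1%g) a_resolvent sG MK.
  rewrite !root_galois_orbit_poly // mul1g invg1 !mul1g; apply.
  exact: (group1 (galois_group L r)).
move/polyOverP/existsNP => [i /negP Mi].
by exists M`_i; rewrite (polyOverP ME) (polyOverP ML).
Qed.

Hypothesis L_sub : {subset L <= adjoin K r}.

Lemma adjoin_over_intermediate : adjoin K r =i adjoin L r.
Proof.
move=> x; apply/idP/idP; apply: adjoin_sub => // y yK; last exact: adjoin_gen.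
- by apply: adjoin_base; apply: sKL.
exact: adjoin_gen.
Qed.

Lemma galois_perms_intermediateP (s : 'S_n) :
  reflect (exists phi, [/\ galois_automorphism K (adjoin K r) phi,
      forall i, phi (tnth r i) = tnth r (s i) & {in L, forall x, phi x = x}])
    (s \in galois_perms L r).
Proof.
rewrite inE; apply: (iffP (asboolP _)) => [[phi phiA phi_r]|[phi [phiA phi_r phiL]]].
  exists phi; split=> //; last by case: phiA.
  have := galois_automorphism_eq (fsym adjoin_over_intermediate) phiA.
  by case=> h1 h2 h3 h4 h5; split=> // x /sKL; apply: h5.
exists phi => //; apply: galois_automorphism_eq adjoin_over_intermediate _.
by case: phiA.
Qed.

End GroundFieldExtension.

(** The elements of [E] fixed by [phi] form a subfield. *)
Lemma galois_automorphism_fix_adjoin (F : fieldType) (K E : divringClosed F) phi s :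
    galois_automorphism K E phi -> {subset K <= E} -> {subset s <= E} ->
    {in s, forall x, phi x = x} ->
  {in adjoin K s, forall x, phi x = x}.
Proof.
move=> [phi_in phiD phiM _ phiK] KE sE phi_s x xKs.
suff [] : x \in E /\ phi x = x by [].
move: x xKs; apply: adjoin_min =>
  [x xK|x xs|x y [xE ex] [yE ey]|x y [xE ex] [yE ey]|x [xE ex]].
- by split; [apply: KE | apply: phiK].
- by split; [apply: sE | apply: phi_s].
- split; first exact: rpredB.
  by apply: (addIr (phi y)); rewrite -phiD ?rpredB // subrK ex ey subrK.
- by rewrite rpredM ?phiM ?ex ?ey.
split; first exact: rpredVr.
have [->|x0] := eqVneq x 0; first by rewrite invr0 phiK ?rpred0.
by apply: (mulIf x0); rewrite -{2}ex -phiM ?rpredVr // mulVf // phiK ?rpred1.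
Qed.

(** * The character of the Galois group defined by [rho] *)

Theorem mainTheorem4 (R : realType) (K : divringClosed R[i])
  (l : nat) (l_prime : prime l)
  (K_unity : forall z : R[i], z ^+ l = 1 -> z \in K)
  (A : R[i]) (A_K : A \in K)
  (A_irr : irreducible_over K ('X^l - A%:P))
  (rho : R[i]) (rho_root : root ('X^l - A%:P) rho)
  (p : {poly R[i]}) (p_K : p \is a polyOver K) (p_neq0 : p != 0)
  (n : nat) (r : n.-tuple R[i]) (r_uniq : uniq r)
  (p_roots : p = lead_coef p *: \prod_(x <- r) ('X - x%:P))
  (a : n.-tuple R[i]) (V_resolvent : is_resolvent K a r)
  (q : {poly R[i]}) (q_irr : irreducible_over K q)
  (q_aux : q %| auxiliary_poly a r)
  (q_red : reducible_over (adjoin K [:: rho]) q) :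
  let G := galois_group K r in
  let H := galois_group (adjoin K [:: rho]) r in
  [/\ H <| G, cyclic (G / H)%g & #|(G / H)%g| = l].
Proof.
move=> G H; set L : divringClosed R[i] := adjoin K [:: rho].
have l_gt0 := prime_gt0 l_prime.
have sKL : {subset K <= L} by apply: adjoin_base.
have rhoL : rho \in L by apply: adjoin_gen; rewrite inE.
have rhoA : rho ^+ l = A by apply/eqP; move: rho_root; rewrite /root !hornerE subr_eq0.
have r_over : \prod_(x <- r) ('X - x%:P) \is a polyOver K.
  have -> : \prod_(x <- r) ('X - x%:P) = (lead_coef p)^-1 *: p.
    by rewrite {2}p_roots scalerA mulVf ?scale1r ?lead_coef_eq0.
  by rewrite polyOverZ // rpredVr // (polyOverP p_K).
have nGH : ~~ (G \subset H).
  apply/negP => /subset_leq_card; apply/negP; rewrite -ltnNge.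
  exact: card_galois_perms_reducible sKL r_over V_resolvent _ q_irr q_aux q_red.
have [y [yE yL yK]] := galois_perms_new_element sKL r_over V_resolvent nGH.
set E : divringClosed R[i] := adjoin K r.
have sKE : {subset K <= E} by apply: adjoin_base.
have rhoE : rho \in E.
  have [f [fK size_f def_y]] := adjoin_radical_horner l_gt0 A_K rhoA yL.
  (* As [y = f.[rho]] lies in [E], [f - y%:P] is a polynomial over [E] of degree below [l] vanishing
     at [rho]; it is nonzero since otherwise [y] would be a coefficient of [f], hence in [K]. *)
  apply: (@prime_radical_in _ E l rho (f - y%:P)) => //.
  - by move=> z /K_unity/sKE.
  - by rewrite rhoA sKE.
  - by rewrite rpredB ?polyOverC //; apply: polyOverS fK.
  - apply: contraNneq yK => /subr0_eq fy.
    by have := polyOverP fK 0; rewrite fy coefC.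
  - by rewrite /root hornerD hornerN hornerC -def_y subrr.
  rewrite (leq_trans (size_polyD _ _)) // geq_max size_f size_polyN.
  by rewrite (leq_trans (size_polyC_leq1 _)).
have sLE : {subset L <= E} by apply: adjoin_sub => // x; rewrite inE => /eqP ->.
have [f fK def_rho] := adjoin_horner r_over V_resolvent 1%g rhoE.
(* With [rho = f.[V 1]], the image of [rho] under the automorphism of [s] is [f.[V s]], so the
   character is defined without choosing automorphisms. *)
pose zeta (s : 'S_n) := f.[resolvent_value a r s] / rho.
have phi_rho (s : 'S_n) phi : galois_automorphism K E phi ->
    (forall i, phi (tnth r i) = tnth r (s i)) ->
    phi rho = f.[resolvent_value a r s].
  move=> phiA phi_r; rewrite def_rho.
  by rewrite (galois_automorphism_horner_value V_resolvent 1%g phiA phi_r fK) mul1g.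
have inH (s : 'S_n) phi : galois_automorphism K E phi ->
    (forall i, phi (tnth r i) = tnth r (s i)) -> phi rho = rho -> s \in H.
  move=> phiA phi_r fix_rho; apply/(galois_perms_intermediateP sKL sLE).
  exists phi; split=> //; apply: galois_automorphism_fix_adjoin phiA sKE _ _.
    by move=> x; rewrite inE => /eqP ->.
  by move=> x; rewrite inE => /eqP ->.
have rho0 : rho != 0.
  (* If [rho] were 0, every automorphism over [K] would fix it, giving [G \subset H]. *)
  apply: contraNneq nGH => rho0; apply/subsetP => s.
  rewrite inE => /asboolP[phi phiA phi_r]; apply: (inH _ _ phiA phi_r).
  by rewrite rho0; case: phiA => _ _ _ _ ->; rewrite ?rpred0.
have zetaE s : f.[resolvent_value a r s] = zeta s * rho by rewrite divfK.
have zeta_l s : s \in G -> zeta s ^+ l = 1.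
  rewrite inE => /asboolP[phi phiA phi_r].
  rewrite expr_div_n -(phi_rho _ _ phiA phi_r).
  have := galois_automorphism_horner sKE phiA rhoE (polyOverXn K l).
  rewrite !hornerXn rhoA => <-.
  by case: phiA => _ _ _ _ -> //; rewrite divff // -rhoA expf_neq0.
apply: (@prime_character_quotient _ G H _ zeta) => //.
(* The automorphism [phi] of [t] is applied to [f.[V s] = zeta s * rho]; it fixes [zeta s], an
   [l]-th root of unity and so in [K]. *)
- move=> s t sG tG; move: (tG); rewrite inE => /asboolP[phi phiA phi_r].
  apply: (mulIf rho0); rewrite -zetaE.
  rewrite -(galois_automorphism_horner_value V_resolvent s phiA phi_r fK).
  have zK := K_unity _ (zeta_l s sG).
  have phi_r' := phi_rho _ _ phiA phi_r.
  case: phiA => _ _ phiM _ phiK.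
  by rewrite zetaE phiM ?(sKE _ zK) // phiK // phi_r' zetaE mulrA.
move=> s; apply/idP/andP => [sH|[]].
  have /(galois_perms_intermediateP sKL sLE)[phi [phiA phi_r phiL]] := sH.
  split; first by rewrite inE; apply/asboolP; exists phi.
  by rewrite /zeta -(phi_rho _ _ phiA phi_r) phiL // divff.
rewrite inE => /asboolP[phi phiA phi_r] /eqP z1.
by apply: (inH _ _ phiA phi_r); rewrite (phi_rho _ _ phiA phi_r) zetaE z1 mul1r.
Qed.
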